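(* Let $\mathbf k$ be a non-archimedean local field of characteristic different from $2$ and let $\bar\alpha\in\mathbf k^*/(\mathbf k^* )^2$ with $-1\notin\bar\alpha$. The hyperbolic disc $\mathbf D_{\bar\alpha}$ is a proper and open $K_{\bar\alpha}$-convex set in $\mathbf S_{\bar\alpha}$. Consequently it inherits a Hilbert distance $d_{\mathbf D_{\bar\alpha}}$.
   Context: Elements of $\mathbf k^*/(\mathbf k^* )^2$ are regarded as subsets of $\mathbf k^*$. $Q(x,y,z)=xz-y^2$ on $\mathbf k^3$, and $B(v,v')=\frac12[Q(v+v')-Q(v-v')]$. $K_{\bar\alpha}=\{\alpha x^2+y^2\in\mathbf k^* : x,y\in\mathbf k^*\}$ for any $\alpha\in\bar\alpha$, an index $2$ subgroup of $\mathbf k^*$. $\mathcal C_{\bar1}=\{(a,b,c)\in\mathbf k^3\setminus\{0\}: ac=b^2,\ a,c \text{ squares in }\mathbf k\ (\text{possibly }0)\}$. $\mathcal H_{\bar\alpha}=\{v\in\mathbf k^3 : B(v,w)\in K_{\bar\alpha}\ \text{for all } w\in\mathcal C_{\bar 1}\}$. The $\bar\alpha$-sphere is $\mathbf S_{\bar\alpha}=(\mathbf k^3\setminus\{0\})/K_{\bar\alpha}$, and the hyperbolic disc $\mathbf D_{\bar\alpha}$ is the image of $\mathcal H_{\bar\alpha}$ in $\mathbf S_{\bar\alpha}$. Convexity: for a finite index subgroup $H\subset\mathbf k^*$ and a finite-dimensional $\mathbf k$-vector space $V$, let $\mathbf S_H(V)=(V\setminus\{0\})/H$. The dual of $\Omega\subset\mathbf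 S_H(V)$ is $\Omega^\circ=\{f\in\mathbf S_H(V^* ): f(x)\in H\ \forall x\in\Omega\}$ (and symmetrically for subsets of $\mathbf S_H(V^* )$); $\Omega$ is $H$-convex if $\Omega=(\Omega^\circ)^\circ$; an $H$-convex $\Omega$ is proper if $\bigcap_{\phi\in\Omega^\circ}\ker\phi=\{0\}$. Hilbert distance: fix a Haar measure $\mu$ on $\mathbf k^*$. For an open proper $H$-convex $\Omega$ and $x,y\in\Omega$, $d_\Omega(x,y)$ is the $\mu$-measure of the smallest symmetric ball containing $\{[\phi,\phi',x,y]:\phi,\phi'\in\Omega^\circ\}$, where $[\phi,\phi',x,y]=\frac{\phi(y)}{\phi(x)}\frac{\phi'(x)}{\phi'(y)}$ and the symmetric ball of radius $r\ge0$ is $\{t\in H:|t-1|\le r,\ |t^{-1}-1|\le r\}$; $d_\Omega$ is a distance on $\Omega$. *)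

(* Defs.v *)
From HB Require Import structures.
From mathcomp Require Import all_boot all_order all_algebra.
From mathcomp Require Import all_classical all_reals all_analysis.
From mathcomp Require Import ring lra.

Set Implicit Arguments.
Unset Strict Implicit.
Unset Printing Implicit Defensive.

Import Order.TTheory GRing.Theory Num.Theory.
Import numFieldNormedType.Exports.

Local Open Scope classical_set_scope.
Local Open Scope ring_scope.

(* A non-archimedean local field: a field with a nontrivial ultrametric
   absolute value whose topology is locally compact.  (MathComp's norms satisfy
   |x *+ n| = |x| *+ n, hence are archimedean; so the absolute value is a
   separate operation.)  The normalization of the absolute value is left free:
   none of the notions below changes when it is raised to a positive power.  *)
HB.mixin Record isNonArchLocalField (R : realType) k
    & GRing.Field k & Uniform k := {
  absv : k -> R ;
  absv_ge0 : forall x : k, 0 <= absv x ;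
  absv_eq0 : forall x : k, absv x = 0 <-> x = 0 ;
  absvM : forall x y : k, absv (x * y) = absv x * absv y ;
  absv_ultra : forall x y : k, absv (x + y) <= Num.max (absv x) (absv y) ;
  absv_nontrivial : exists2 x : k, x != 0 & absv x != 1 ;
  absv_entourage :
    entourage = entourage_ (fun (x : k) (e : R) => [set y | absv (x - y) < e]) ;
  local_field_locally_compact : locally_compact [set: k]
}.

#[short(type="localFieldType")]
HB.structure Definition NonArchLocalField (R : realType) :=
  { k of GRing.Field k & Uniform k & isNonArchLocalField R k }.

Section LocalFieldTheory.
Variables (R : realType) (k : localFieldType R).
Implicit Types (x y z w t : k).

Lemma absv0 : absv (0 : k) = 0.
Proof. by apply/absv_eq0. Qed.

Lemma absv_gt0 x : (0 < absv x) = (x != 0).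
Proof.
rewrite lt_neqAle absv_ge0 andbT eq_sym; congr (~~ _).
by apply/eqP/eqP => /absv_eq0.
Qed.

Lemma absv1 : absv (1 : k) = 1.
Proof.
have n0 : absv (1 : k) != 0 by rewrite gt_eqF// absv_gt0 oner_neq0.
by apply: (mulfI n0); rewrite -absvM !mulr1.
Qed.

Lemma absvN x : absv (- x) = absv x.
Proof.
have e : absv (-1 : k) = 1.
  apply/eqP; rewrite -(@pexpr_eq1 _ _ 2)//; last exact: absv_ge0.
  by rewrite expr2 -absvM mulrNN mulr1 absv1.
by rewrite -mulN1r absvM e mul1r.
Qed.

Lemma absv_sub_ultra x y : absv (x - y) <= Num.max (absv x) (absv y).
Proof. by rewrite -[absv y]absvN; exact: absv_ultra. Qed.

Lemma absv_distC x y : absv (x - y) = absv (y - x).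
Proof. by rewrite -absvN opprB. Qed.

Lemma absvV x : absv x^-1 = (absv x)^-1.
Proof.
have [->|x0] := eqVneq x 0; first by rewrite invr0 absv0 invr0.
have n0 : absv x != 0 by rewrite gt_eqF// absv_gt0.
by apply: (mulfI n0); rewrite -absvM !mulfV// absv1.
Qed.

Lemma absvX x n : absv (x ^+ n) = absv x ^+ n.
Proof. by elim: n => [|n ih]; rewrite ?expr0 ?absv1// !exprS absvM ih. Qed.

Lemma ler_absvD x y : absv (x + y) <= absv x + absv y.
Proof.
rewrite (le_trans (absv_ultra _ _))// ge_max lerDl lerDr.
by rewrite !absv_ge0.
Qed.

Lemma ler_absv_dist x y : `|absv x - absv y| <= absv (x - y).
Proof.
have h x' y' : absv x' - absv y' <= absv (x' - y').
  by rewrite lerBlDr -{1}[x'](subrK y') ler_absvD.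
by rewrite ler_norml h andbT lerNl opprB absv_distC h.
Qed.

Lemma nbhs_absvP x (A : set k) :
  nbhs x A <-> exists2 e : R, 0 < e & forall y, absv (x - y) < e -> A y.
Proof.
rewrite -nbhs_entourageE; split.
  move=> [E]; rewrite absv_entourage => -[e /= e0 eE] EA.
  by exists e => // y xy; apply: EA; apply/xsectionP; exact: (eE (x, y)).
move=> [e e0 eA]; exists [set xy : k * k | absv (xy.1 - xy.2) < e].
  by rewrite absv_entourage; exists e.
by move=> y /xsectionP; exact: eA.
Qed.

Lemma absv_continuous : continuous (absv : k -> R).
Proof.
move=> x; apply/cvgrPdist_lt => e e0; apply/nbhs_absvP; exists e => // y.
by apply: le_lt_trans; exact: ler_absv_dist.
Qed.

Lemma closed_absv_le (r : R) : closed [set x : k | absv x <= r].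
Proof.
apply: (@preimage_closed _ _ (absv : k -> R) [set y | y <= r]).
  by move=> x _; exact: absv_continuous.
exact: closed_le.
Qed.

Lemma closed_absv_ge (r : R) : closed [set x : k | r <= absv x].
Proof.
apply: (@preimage_closed _ _ (absv : k -> R) [set y | r <= y]).
  by move=> x _; exact: absv_continuous.
exact: closed_ge.
Qed.

Lemma compact_small_ball :
  exists2 r : R, 0 < r < 1 & compact [set x : k | absv x <= r].
Proof.
have [U /= U0 [cU _]] := @local_field_locally_compact R k 0 I.
have : nbhs (0 : k) [set x | [set: k] x -> U x] := U0.
move=> /nbhs_absvP[e e0 eU].
exists (Num.min e 1 / 2).
  by rewrite divr_gt0 ?lt_min ?e0//= ltr_pdivrMr// mul1r gt_min ltr1n orbT.
apply: subclosed_compact cU _; first exact: closed_absv_le.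
move=> x /= xe; apply: eU => //; rewrite sub0r absvN (le_lt_trans xe)//.
rewrite ltr_pdivrMr// gt_min; apply/orP; left.
by rewrite ltr_pMr// ltr1n.
Qed.

Lemma exists_absv_lt1 : exists2 t : k, t != 0 & absv t < 1.
Proof.
have [t t0 t1] := @absv_nontrivial R k.
have [lt1|] := ltP (absv t) 1; first by exists t.
rewrite le_eqVlt eq_sym (negbTE t1)/= => gt1.
by exists t^-1; rewrite ?invr_eq0// absvV invf_lt1// absv_gt0.
Qed.

Lemma absv_1D x : absv x < 1 -> absv (1 + x) = 1.
Proof.
move=> x1; apply/eqP; rewrite eq_le; apply/andP; split.
  by rewrite (le_trans (absv_ultra _ _))// absv1 ge_max lexx ltW.
have : absv (1 + x - x) <= Num.max (absv (1 + x)) (absv x).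
  exact: absv_sub_ultra.
by rewrite addrK absv1 le_max => /orP[//|]; rewrite leNgt x1.
Qed.

Lemma absv_expr_lt t (e : R) : absv t < 1 -> 0 < e -> exists n, absv t ^+ n < e.
Proof.
move=> t1 e0; have ct : `|absv t| < 1 by rewrite ger0_norm// absv_ge0.
have /cvgrPdist_lt/(_ e e0)[n _ /(_ n (leqnn n))] := cvg_expr ct.
by rewrite /= sub0r normrN ger0_norm ?exprn_ge0 ?absv_ge0// => h; exists n.
Qed.

(* Newton's method, at a minimum of |w^2 + 2 w - z| on a compact ball. *)
Lemma near1_square : (2 : k) != 0 ->
  exists2 d : R, 0 < d & forall z, absv z < d -> exists2 w, w != 0 & 1 + z = w ^+ 2.
Proof.
move=> n2; have [r /andP[r0 r1] cB] := compact_small_ball.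
have a2 : 0 < absv (2 : k) by rewrite absv_gt0.
exists (Num.min (absv (2 : k) ^+ 2) (r * absv (2 : k))).
  by rewrite lt_min exprn_gt0// mulr_gt0.
move=> z; rewrite lt_min => /andP[z4 zr].
pose p w := w ^+ 2 + 2 * w - z.
have cp : continuous (fun w => absv (p w)).
  move=> w; apply/cvgrPdist_lt => e e0; apply/nbhs_absvP.
  pose M := absv (2 * w + 2) + 1.
  have M0 : 0 < M by rewrite ltr_pwDr// absv_ge0.
  exists (Num.min 1 (e / M)); first by rewrite lt_min ltr01 divr_gt0.
  move=> y; rewrite lt_min => /andP[y1 ye].
  apply: le_lt_trans (ler_absv_dist _ _) _.
  have -> : p w - p y = (w - y) * (2 * w + 2 - (w - y)) by rewrite /p; ring.
  rewrite absvM.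
  have : absv (2 * w + 2 - (w - y)) <= M.
    rewrite (le_trans (absv_sub_ultra _ _))// ge_max lerDl ler01/=.
    by rewrite (le_trans (ltW y1))// lerDr absv_ge0.
  move=> /(ler_wpM2l (absv_ge0 (w - y)))/le_lt_trans; apply.
  by rewrite -ltr_pdivlMr.
have B0 : [set x : k | absv x <= r] !=set0.
  by exists 0; rewrite /= absv0 ltW.
have /(compact_EVT_min B0 cB)[c /[!inE]/= cr cmin] :
    {within [set x : k | absv x <= r], continuous (fun w => absv (p w))}.
  exact: continuous_subspaceT.
have c1 : absv (1 + c) = 1 by apply: absv_1D; exact: le_lt_trans r1.
have c10 : 1 + c != 0 by rewrite -absv_gt0 c1.
suff pc0 : p c = 0.
  exists (1 + c) => //; have -> : (1 + c) ^+ 2 = 1 + z + p c by rewrite /p; ring.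
  by rewrite pc0 addr0.
apply: contrapT => /eqP pc0.
have pcz : absv (p c) <= absv z.
  have /cmin : 0 \in [set x : k | absv x <= r] by rewrite inE/= absv0 ltW.
  by rewrite /p expr0n/= mulr0 !add0r absvN.
pose u := p c / (2 * (1 + c)).
have au : absv u = absv (p c) / absv (2 : k).
  by rewrite /u absvM absvV absvM c1 mulr1.
have pu : p (c - u) = u ^+ 2.
  have : p c = u * (2 * (1 + c)) by rewrite divfK// mulf_neq0.
  rewrite /p => pcE.
  have -> : (c - u) ^+ 2 + 2 * (c - u) - z
            = (c ^+ 2 + 2 * c - z) - u * (2 * (1 + c)) + u ^+ 2 by ring.
  by rewrite pcE subrr add0r.
have : absv (p c) <= absv (p (c - u)).
  apply: cmin; rewrite inE/= (le_trans (absv_sub_ultra _ _))// ge_max cr/=.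
  by rewrite au ler_pdivrMr// (le_trans pcz)// ltW.
rewrite pu absvX au leNgt => /negP; apply.
rewrite expr_div_n ltr_pdivrMr ?exprn_gt0// expr2 ltr_pM2l ?absv_gt0//.
exact: le_lt_trans pcz _.
Qed.

Lemma annulus_squares (t : k) (r : R) x : t != 0 -> absv t < 1 -> 0 < r -> x != 0 ->
  exists2 c, c != 0 & r * absv t ^+ 2 <= absv (x * c ^+ 2) <= r.
Proof.
move=> t0 t1 r0 x0; have at0 : 0 < absv t by rewrite absv_gt0.
have ax0 : 0 < absv x by rewrite absv_gt0.
have t21 : absv (t ^+ 2) < 1 by rewrite absvX expr_lt1// absv_ge0.
have [M hM] : exists M, absv (t ^+ 2) ^+ M < absv x / r.
  by apply: absv_expr_lt => //; rewrite divr_gt0.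
pose x' := x / (t ^+ M) ^+ 2.
have x'r : r < absv x'.
  rewrite absvM absvV ltr_pdivlMr ?absv_gt0 ?expf_neq0//.
  by rewrite mulrC -ltr_pdivlMr// -exprM mulnC exprM absvX.
have ax' : 0 < absv x' by exact: lt_trans x'r.
have ex : exists n, absv (x' * (t ^+ n) ^+ 2) <= r.
  have [n hn] : exists n, absv (t ^+ 2) ^+ n < r / absv x'.
    by apply: absv_expr_lt => //; rewrite divr_gt0.
  exists n; rewrite absvM mulrC ltW// -ltr_pdivlMr//.
  by rewrite -exprM mulnC exprM absvX.
case: (ex_minnP ex) => -[|n] hn nmin.
  by move: hn; rewrite expr0 expr1n mulr1 leNgt x'r.
exists (t ^+ n.+1 / t ^+ M); first by rewrite mulf_neq0 ?invr_eq0 ?expf_neq0.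
have -> : x * (t ^+ n.+1 / t ^+ M) ^+ 2 = x' * (t ^+ n.+1) ^+ 2.
  by rewrite /x' expr_div_n; ring.
rewrite hn andbT.
have -> : x' * (t ^+ n.+1) ^+ 2 = x' * (t ^+ n) ^+ 2 * t ^+ 2.
  by rewrite (exprS t n); ring.
rewrite absvM absvX ler_pM2r ?exprn_gt0//.
rewrite leNgt; apply/negP => /ltW/nmin.
by rewrite ltnn.
Qed.

Lemma finite_index_squares : (2 : k) != 0 ->
  exists s : seq k, forall x, x != 0 ->
    exists2 y, y \in s & exists2 w, w != 0 & x / y = w ^+ 2.
Proof.
move=> n2; have [d d0 dsq] := near1_square n2.
have [r /andP[r0 _] cB] := compact_small_ball.
have [t t0 t1] := exists_absv_lt1.
have at0 : 0 < absv t by rewrite absv_gt0.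
pose A := [set x : k | r * absv t ^+ 2 <= absv x <= r].
have cA : compact A.
  apply: subclosed_compact cB _; last by move=> x /andP[].
  have -> : A = [set x | r * absv t ^+ 2 <= absv x] `&` [set x | absv x <= r].
    by apply/seteqP; split => x /=; [move=> /andP|move=> /andP].
  by apply: closedI; [exact: closed_absv_ge|exact: closed_absv_le].
have A0 x : A x -> x != 0.
  move=> /andP[+ _]; rewrite -absv_gt0; apply: lt_le_trans.
  by rewrite mulr_gt0// exprn_gt0.
pose kp : ptopologicalType :=
  HB.pack (k : Type) (Topological.on k) (isPointed.Build k 0).
have : cover_compact A by rewrite -(@compact_cover kp).
move=> /(_ _ A (fun x => [set y | absv (y / x - 1) < d]^°))[||D DA cov].
- by move=> x _; exact: open_interior.
- move=> x Ax; exists x => //; apply/nbhs_absvP.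
  have x0 := A0 _ Ax; have ax0 : 0 < absv x by rewrite absv_gt0.
  exists (d * absv x); first exact: mulr_gt0.
  move=> y /= xy; have -> : y / x - 1 = (y - x) / x by rewrite mulrBl mulfV.
  by rewrite absvM absvV ltr_pdivrMr// absv_distC.
exists (finmap.enum_fset D) => x x0.
have [c c0 Axc] := annulus_squares t0 t1 r0 x0.
have [y /= yD /interior_subset/= hy] := cov _ Axc.
exists y => //; have y0 : y != 0 by apply: A0; have := DA _ yD; rewrite inE.
have [w w0] := dsq _ hy; rewrite addrC subrK => ww.
exists (w / c); first by rewrite mulf_neq0 ?invr_eq0.
by rewrite expr_div_n -ww; field; rewrite c0 y0.
Qed.

End LocalFieldTheory.

Section FiniteIndexSubgroups.
Variable k : fieldType.

(* Finite index: finitely many cosets y * H cover the nonzero elements; H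
   avoids 0, so such a y is automatically nonzero. *)
Record fiSubgroup := FiSubgroup {
  fi_carrier :> k -> Prop ;
  fi_neq0 : forall x, fi_carrier x -> x != 0 ;
  fi1 : fi_carrier 1 ;
  fiM : forall x y, fi_carrier x -> fi_carrier y -> fi_carrier (x * y) ;
  fiV : forall x, fi_carrier x -> fi_carrier x^-1 ;
  fi_index : exists s : seq k,
    forall x, x != 0 -> exists2 y, y \in s & fi_carrier (x / y)
}.

(* Elements of k^* / (k^* )^2, regarded as subsets of k^*. *)
Record squareClass := SquareClass {
  sqc :> k -> Prop ;
  sqcP : exists2 a, a != 0 & sqc = [set a * x ^+ 2 | x in [set x | x != 0]]
}.

End FiniteIndexSubgroups.

Section Sphere.
Variables (k : fieldType) (H : fiSubgroup k) (V : vectType k).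

Definition nonzero : set V := [set v | v != 0].

Definition same_ray (u v : nonzero) : bool :=
  `[< exists2 t, H t & set_val u = t *: set_val v >].

Lemma same_ray_refl : reflexive same_ray.
Proof. by move=> u; apply/asboolP; exists 1; [exact: fi1|rewrite scale1r]. Qed.

Lemma same_ray_sym : symmetric same_ray.
Proof.
suff h u v : same_ray u v -> same_ray v u.
  by move=> u v; apply/idP/idP; exact: h.
move=> /asboolP[t Ht uv]; apply/asboolP; exists t^-1; first exact: fiV.
by rewrite uv scalerA mulVf ?scale1r//; exact: fi_neq0 Ht.
Qed.

Lemma same_ray_trans : transitive same_ray.
Proof.
move=> v u w /asboolP[s Hs uv] /asboolP[t Ht vw]; apply/asboolP.
by exists (s * t); [exact: fiM|rewrite uv vw scalerA].
Qed.

Canonical same_ray_equiv :=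
  EquivRel same_ray same_ray_refl same_ray_sym same_ray_trans.

Definition sphere := {eq_quot same_ray}%qT.

HB.instance Definition _ := Choice.on sphere.
HB.instance Definition _ := Quotient.on sphere.

Definition rep (x : sphere) : V := set_val (repr x).

End Sphere.

Arguments nonzero {k} V.
Arguments sphere {k} H V.

Section Convexity.
Variables (k : fieldType) (H : fiSubgroup k) (V : vectType k).

Local Notation dualV := 'Hom(V, k^o).

(* The value f(x), defined only up to multiplication by an element of H, is
   taken at chosen representatives. *)
Definition pairing (f : sphere H dualV) (x : sphere H V) : k := rep f (rep x).

Definition dual (Omega : set (sphere H V)) : set (sphere H dualV) :=
  [set f | forall x, Omega x -> H (pairing f x)].

Definition predual (Phi : set (sphere H dualV)) : set (sphere H V) :=
  [set x | forall f, Phi f -> H (pairing f x)].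

Definition Hconvex (Omega : set (sphere H V)) : Prop :=
  Omega = predual (dual Omega).

Definition Hproper (Omega : set (sphere H V)) : Prop :=
  [set v : V | forall f, dual Omega f -> rep f v = 0] = [set 0].

Definition cross_ratio (f f' : sphere H dualV) (x y : sphere H V) : k :=
  pairing f y / pairing f x * (pairing f' x / pairing f' y).

Definition cross_ratios (Omega : set (sphere H V)) (x y : sphere H V) : set k :=
  [set t | exists f f',
     [/\ dual Omega f, dual Omega f' & t = cross_ratio f f' x y]].

End Convexity.

Definition sphere_open (R : realType) (k : localFieldType R)
    (H : fiSubgroup k) (n : nat) (Omega : set (sphere H 'rV[k]_n)) : Prop :=
  open (Omega : set (quotient_topology (sphere H 'rV[k]_n))).

Section HilbertDistance.
Variables (R : realType) (k : localFieldType R).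

Definition kstar : Type := set_type [set x : k | x != 0].

HB.instance Definition _ := Topological.copy kstar (set_type [set x : k | x != 0]).
HB.instance Definition _ :=
  isPointed.Build kstar (SigSub (mem_set (oner_neq0 k : [set x : k | x != 0] 1))).

Definition kstar_val (x : kstar) : k := set_val x.

Local Notation borel_kstar := (g_sigma_algebraType (@open kstar)).

Definition is_haar (mu : {measure set borel_kstar -> \bar R}) : Prop :=
  [/\ forall (a : kstar) (A : set borel_kstar), measurable A ->
        mu [set y | exists2 x, A x & kstar_val y = kstar_val a * kstar_val x]
        = mu A,
      forall A : set kstar, compact A -> (mu A < +oo)%E &
      forall A : set kstar, open A -> A !=set0 -> (0 < mu A)%E].

Variable (H : fiSubgroup k).

Definition symmetric_ball (r : R) : set k :=
  [set t | [/\ H t, absv (t - 1) <= r & absv (t^-1 - 1) <= r]].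

Definition is_smallest_ball (X B : set k) : Prop :=
  [/\ exists2 r, 0 <= r & B = symmetric_ball r,
      X `<=` B &
      forall r, 0 <= r -> X `<=` symmetric_ball r -> B `<=` symmetric_ball r].

(* The default value setT, taken when no symmetric ball contains X, has
   infinite Haar measure. *)
Definition smallest_ball (X : set k) : set k :=
  xget setT [set B | is_smallest_ball X B].

Definition hilbert_dist (mu : {measure set borel_kstar -> \bar R})
    (V : vectType k) (Omega : set (sphere H V)) (x y : sphere H V) : \bar R :=
  mu (kstar_val @^-1` smallest_ball (cross_ratios Omega x y)).

End HilbertDistance.

Definition is_distance_on (R : realType) (T : Type) (A : set T)
    (d : T -> T -> \bar R) : Prop :=
  [/\ forall x y, A x -> A y -> d x y \is a fin_num /\ (0 <= d x y)%E,
      forall x y, A x -> A y -> (d x y = 0%E <-> x = y),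
      forall x y, A x -> A y -> d x y = d y x &
      forall x y z, A x -> A y -> A z -> (d x z <= d x y + d y z)%E].

Section HyperbolicDisc.
Variables (R : realType) (k : localFieldType R).

Definition quadQ (v : 'rV[k]_3) : k := v 0 0 * v 0 2 - v 0 1 ^+ 2.

Definition bilinB (v w : 'rV[k]_3) : k :=
  2^-1 * (quadQ (v + w) - quadQ (v - w)).

Definition coneC1 : set 'rV[k]_3 :=
  [set v | [/\ v != 0, v 0 0 * v 0 2 = v 0 1 ^+ 2,
               exists p, v 0 0 = p ^+ 2 & exists q, v 0 2 = q ^+ 2]].

Variable alpha : squareClass k.

(* Any one representative a of alpha gives the same set: see Kset_any. *)
Definition Kset : set k :=
  [set t | t != 0 /\
    exists a x y, [/\ alpha a, x != 0, y != 0 & t = a * x ^+ 2 + y ^+ 2]].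

Definition hyp_cone : set 'rV[k]_3 :=
  [set v | forall w, coneC1 w -> Kset (bilinB v w)].

Lemma sqc_neq0 a : alpha a -> a != 0.
Proof.
have [b b0 ->] := sqcP alpha => -[x x0 <-]; by rewrite mulf_neq0 ?expf_neq0.
Qed.

Lemma sqcZ a x : alpha a -> x != 0 -> alpha (a * x ^+ 2).
Proof.
have [b b0 ->] := sqcP alpha => -[y y0 <-] x0; exists (y * x).
  exact: mulf_neq0.
by rewrite exprMn mulrA.
Qed.

Lemma sqc_ratio a b : alpha a -> alpha b -> exists2 x, x != 0 & b = a * x ^+ 2.
Proof.
have [c c0 ->] := sqcP alpha => -[y y0 <-] [z z0 <-]; exists (z / y).
  by rewrite mulf_neq0 ?invr_eq0.
by field.
Qed.

Lemma sqc_inhabited : exists a, alpha a.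
Proof.
by have [a a0 ->] := sqcP alpha; exists a; exists 1; rewrite ?expr1n ?mulr1//= oner_neq0.
Qed.

Lemma Kset_any a : alpha a ->
  Kset = [set t | t != 0 /\ exists x y, [/\ x != 0, y != 0 & t = a * x ^+ 2 + y ^+ 2]].
Proof.
move=> alpha_a; apply/seteqP; split => t [t0].
  move=> [b [x [y [alpha_b x0 y0 tE]]]]; split=> //; rewrite tE.
  have [z z0 ->] := sqc_ratio alpha_a alpha_b; exists (z * x), y.
  by split=> //; [exact: mulf_neq0|ring].
by move=> [x [y [x0 y0 tE]]]; split=> //; exists a, x, y.
Qed.

Hypotheses (char2 : 2%N \notin [pchar k]) (alphaN1 : ~ alpha (-1)).

Let two_neq0 : (2 : k) != 0.
Proof. by apply: contraNneq char2 => h; rewrite inE/= h eqxx. Qed.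

Lemma sqc_form_neq0 a x : alpha a -> 1 + a * x ^+ 2 != 0.
Proof.
move=> alpha_a; apply/negP => /eqP/(canRL (addKr _)); rewrite addr0 => e.
apply: alphaN1; rewrite -e; apply: sqcZ => //.
by apply/negP => /eqP x0; move/eqP: e; rewrite x0 expr0n/= mulr0 eq_sym oppr_eq0 oner_eq0.
Qed.

Lemma Kset1 : Kset 1.
Proof.
have [a alpha_a] := sqc_inhabited.
have [s s0 as1] : exists2 s, s != 0 & 1 - a * s ^+ 2 != 0.
  have [t t0 t1] := exists_absv_lt1 k.
  have [a1|a1] := eqVneq a 1; last first.
    by exists 1; rewrite ?oner_neq0// expr1n mulr1 subr_eq0 eq_sym.
  exists t => //; rewrite a1 mul1r subr_eq0; apply/negP => /eqP/(congr1 absv).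
  rewrite absv1 absvX => /esym e.
  have : absv t ^+ 2 < 1 by rewrite expr_lt1// absv_ge0.
  by rewrite e ltxx.
have q0 := sqc_form_neq0 s alpha_a.
split; first exact: oner_neq0.
exists a, (2 * s / (1 + a * s ^+ 2)), ((1 - a * s ^+ 2) / (1 + a * s ^+ 2)).
split=> //; first by rewrite !mulf_neq0 ?invr_eq0.
  by rewrite mulf_neq0 ?invr_eq0.
by field.
Qed.

(* The degenerate values of the form, with x = 0 or y = 0, also lie in K. *)
Lemma Kset_form a x y : alpha a -> a * x ^+ 2 + y ^+ 2 != 0 ->
  Kset (a * x ^+ 2 + y ^+ 2).
Proof.
move=> alpha_a t0; have [_] := Kset1; rewrite (Kset_any alpha_a).
move=> [b [p [q [alpha_b p0 q0 pq]]]].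
have {b p q alpha_b p0 q0 pq}[p [q [p0 q0 pq]]] :
    exists p q, [/\ p != 0, q != 0 & 1 = a * p ^+ 2 + q ^+ 2].
  have [r r0 br] := sqc_ratio alpha_a alpha_b; exists (r * p), q; split=> //.
    exact: mulf_neq0.
  by rewrite pq br; ring.
have a0 := sqc_neq0 alpha_a; split => //.
have [x0|x0] := eqVneq x 0.
  have y0 : y != 0.
    by apply: contraNneq t0 => ->; rewrite x0 !expr0n/= mulr0 addr0.
  exists (p * y), (q * y); split; rewrite ?mulf_neq0//.
  by rewrite x0 expr0n/= mulr0 add0r -[LHS]mul1r pq; ring.
have [y0|y0] := eqVneq y 0; last by exists x, y.
exists (q * x), (a * p * x); split; rewrite ?mulf_neq0//.
rewrite y0 expr0n/= addr0 -[LHS]mul1r pq; ring.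
Qed.

Lemma Kset_neq0 t : Kset t -> t != 0.
Proof. by case. Qed.

Lemma KsetM s t : Kset s -> Kset t -> Kset (s * t).
Proof.
have [a alpha_a] := sqc_inhabited.
move=> Ks Kt; have st0 : s * t != 0 by rewrite mulf_neq0 ?Kset_neq0.
move: Ks Kt st0; rewrite {1 2}(Kset_any alpha_a).
move=> [_ [x [y [_ _ ->]]]] [_ [z [w [_ _ ->]]]].
have -> : (a * x ^+ 2 + y ^+ 2) * (a * z ^+ 2 + w ^+ 2)
          = a * (x * w + y * z) ^+ 2 + (y * w - a * x * z) ^+ 2 by ring.
exact: Kset_form.
Qed.

Lemma Kset_sqr x : x != 0 -> Kset (x ^+ 2).
Proof.
have [a alpha_a] := sqc_inhabited => x0.
have -> : x ^+ 2 = a * 0 ^+ 2 + x ^+ 2 by rewrite expr0n/= mulr0 add0r.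
by apply: Kset_form => //; rewrite expr0n/= mulr0 add0r expf_neq0.
Qed.

Lemma KsetV t : Kset t -> Kset t^-1.
Proof.
move=> Kt; have t0 := Kset_neq0 Kt.
have -> : t^-1 = t * t^-1 ^+ 2 by field.
by apply: KsetM => //; apply: Kset_sqr; rewrite invr_eq0.
Qed.

Lemma Kset_index : exists s : seq k,
  forall x, x != 0 -> exists2 y, y \in s & Kset (x / y).
Proof.
have [s hs] := finite_index_squares two_neq0; exists s => x /hs[y ys [w w0 xy]].
by exists y => //; rewrite xy; exact: Kset_sqr.
Qed.

Definition Kgroup : fiSubgroup k := FiSubgroup Kset_neq0 Kset1 KsetM KsetV Kset_index.

Definition hyp_disc : set (sphere Kgroup 'rV[k]_3) :=
  [set \pi_(sphere Kgroup 'rV[k]_3)%qT v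
     | v in [set v : nonzero 'rV[k]_3 | hyp_cone (set_val v)]].

End HyperbolicDisc.

Arguments hyp_disc {R k alpha} char2 alphaN1.

(* Main.v *)
(* The disc is the dual of the cone C_1, read through the form B: the functionals
   B(., w) with w in C_1 lie in the dual of the disc, which gives convexity, and
   properness because C_1 spans k^3.  On C_1 the function B(v, .) is a binary
   quadratic form; for v in the cone over the disc it is anisotropic, so
   |B(v, w)| >= c |w|, and a small change of v multiplies B(v, w) by an element
   close to 1, that is by a square: the disc is open.

   For the distance, openness bounds the cross-ratios.  The triangle inequality
   reduces to mu(B(r) B(s)) <= mu(B(r)) + mu(B(s)) for symmetric balls: if r <= s
   and r <= 1 then B(r) B(s) = B(s), while for r, s > 1 the product lies in an
   annulus covered by a translate of B(r) and a translate of B(s). *)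

Require Import Defs.
From HB Require Import structures.
From mathcomp Require Import all_boot all_order all_algebra.
From mathcomp Require Import all_classical all_reals all_analysis.
From mathcomp Require Import ring.

Set Implicit Arguments.
Unset Strict Implicit.
Unset Printing Implicit Defensive.

Import Order.TTheory GRing.Theory Num.Theory.
Import numFieldNormedType.Exports.

Local Open Scope classical_set_scope.
Local Open Scope ring_scope.

(** * Compactness in [k] and the topology of [k^*] *)

Section LocalField.
Variables (R : realType) (k : localFieldType R).
Implicit Types (x y z t : k).

Lemma mulr_absv_continuous a : continuous ( *%R a : k -> k).
Proof.
move=> x A /= /nbhs_absvP[e e0 eA]; apply/nbhs_absvP.
have M0 : 0 < absv a + 1 by rewrite ltr_wpDl ?absv_ge0.
exists (e / (absv a + 1)); first by rewrite divr_gt0.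
move=> y; rewrite ltr_pdivlMr// => xy; apply: eA; rewrite -mulrBr absvM.
by rewrite mulrC (le_lt_trans _ xy)// ler_wpM2l ?absv_ge0// lerDl.
Qed.

Lemma addr_absv_continuous a : continuous ( +%R a : k -> k).
Proof.
move=> x A /= /nbhs_absvP[e e0 eA]; apply/nbhs_absvP; exists e => // y xy.
by apply: eA; rewrite opprD addrACA subrr add0r.
Qed.

Lemma nbhs_neq0 x : x != 0 -> nbhs x [set y | y != 0].
Proof.
move=> x0; apply/nbhs_absvP; exists (absv x); first by rewrite absv_gt0.
by move=> y xy; apply: contraTneq xy => ->; rewrite subr0 ltxx.
Qed.

(** Dilating the small compact ball by [(t ^+ n)^-1], with [|t| < 1] and [n] large, gives a compact
    set that contains the given closed ball. *)
Lemma compact_absv_le (r : R) : compact [set x : k | absv x <= r].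
Proof.
have [e /andP[e0 _] ce] := compact_small_ball k.
have [t t0 t1] := exists_absv_lt1 k.
have r0 : 0 < Num.max r 1 by rewrite lt_max ltr01 orbT.
have [n tn] : exists n, absv t ^+ n < e / Num.max r 1.
  by apply: absv_expr_lt => //; rewrite divr_gt0.
have ct : compact [set (t ^+ n)^-1 * x | x in [set x : k | absv x <= e]].
  apply: continuous_compact ce; apply: continuous_subspaceT.
  exact: mulr_absv_continuous.
apply: subclosed_compact ct _; first exact: closed_absv_le.
move=> x /= xr; exists (t ^+ n * x); last by rewrite mulKf// expf_neq0.
rewrite /= absvM absvX.
apply: le_trans (_ : e / Num.max r 1 * Num.max r 1 <= _).
  by rewrite ler_pM ?exprn_ge0 ?absv_ge0 ?(ltW tn)// le_max xr.
by rewrite divfK// gt_eqF.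
Qed.

(** The quotient [x / y] is 1 plus an element of absolute value below 1. *)
Lemma absv_eq_near x y : absv (x - y) < absv y -> absv x = absv y.
Proof.
move=> xy; have y0 : y != 0 by rewrite -absv_gt0 (le_lt_trans _ xy)// absv_ge0.
have -> : x = y * (1 + (x - y) / y) by field.
rewrite absvM absv_1D ?mulr1// absvM absvV ltr_pdivrMr ?absv_gt0//.
by rewrite mul1r.
Qed.

Definition to_kstar x (x0 : x != 0) : kstar k :=
  SigSub (mem_set (x0 : [set x : k | x != 0] x)).

Lemma to_kstarK x (x0 : x != 0) : kstar_val (to_kstar x0) = x.
Proof. by []. Qed.

Lemma kstar_val_neq0 (x : kstar k) : kstar_val x != 0.
Proof. exact: (set_mem (valP x)). Qed.

Lemma kstar_val_inj : injective (@kstar_val R k).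
Proof. by move=> x y; exact: val_inj. Qed.

Lemma kstar_val_continuous : continuous (@kstar_val R k).
Proof. exact: initial_continuous. Qed.

Lemma closed_kstar_preimage (A : set k) :
  closed A -> closed (@kstar_val R k @^-1` A).
Proof. by apply: preimage_closed => x _; exact: kstar_val_continuous. Qed.

(** Since [kstar] carries the initial topology of [kstar_val], a section of [kstar_val] is
    continuous on [A]: its composite with [kstar_val] is the identity there. The preimage is the
    image of [A] under such a section. *)
Lemma compact_kstar_preimage (A : set k) :
  compact A -> ~ A 0 -> compact (@kstar_val R k @^-1` A).
Proof.
move=> cA A0.
(* The value 1 at 0 is arbitrary, as [A] avoids 0. *)
pose g (x : k) : kstar k :=
  if eqVneq x 0 is NeqNotEq x0 then to_kstar x0 else to_kstar (oner_neq0 k).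
have gE x : x != 0 -> kstar_val (g x) = x.
  by rewrite /g; case: eqVneq.
have -> : @kstar_val R k @^-1` A = g @` A.
  apply/seteqP; split=> [y /= Ay|y [x Ax <-]] /=.
    by exists (kstar_val y) => //; apply: kstar_val_inj; rewrite gE ?kstar_val_neq0.
  by rewrite gE//; apply/eqP => x0; apply: A0; rewrite -x0.
apply: (@continuous_compact _ (kstar k) g _ _ cA).
have cg : {within A, continuous (@kstar_val R k \o g)}.
  apply: (@subspace_eq_continuous _ A k idfun (@kstar_val R k \o g)); last first.
    by apply: continuous_subspaceT => x; exact: cvg_id.
  move=> x /[!inE] Ax; rewrite /= gE//; apply/eqP => x0.
  by apply: A0; rewrite -x0.
exact: (@continuous_comp_initial _ (subspace A) k set_val g cg).
Qed.

End LocalField.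

(** * Symmetric balls of a subgroup containing a neighbourhood of 1 *)

Section SymmetricBall.
Variables (R : realType) (k : localFieldType R) (H : fiSubgroup k).
Hypothesis open_subgroup :
  exists2 d : R, 0 < d & forall z, absv z < d -> H (1 + z).
Implicit Types (x y z t : k) (r s : R) (X : set k).

Local Notation ball := (symmetric_ball H).

Lemma symball_homo r s : r <= s -> ball r `<=` ball s.
Proof. by move=> rs t [Ht t1 t2]; split=> //; exact: le_trans rs. Qed.

Lemma symball1 r : 0 <= r -> ball r 1.
Proof. by move=> r0; split; rewrite ?invr1 ?subrr ?absv0//; exact: fi1. Qed.

Lemma symballV r t : ball r t -> ball r t^-1.
Proof. by move=> [Ht t1 t2]; split; rewrite ?invrK//; exact: fiV. Qed.

Lemma symball_absv_le r t : ball r t -> absv t <= Num.max r 1.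
Proof.
move=> [_ t1 _]; rewrite -[t](subrK 1) (le_trans (absv_ultra _ _))//.
by rewrite absv1 ge_max le_max t1/= le_max lexx orbT.
Qed.

(** For [r >= 1] the balls are exactly the annuli [r^-1 <= |t| <= r] of [H]; the converse is
    [symball_absv_le], applied to [t] and to its inverse. *)
Lemma absv_le_symball r t :
  1 <= r -> H t -> absv t <= r -> absv t^-1 <= r -> ball r t.
Proof.
move=> r1 Ht t1 t2.
by split=> //; rewrite (le_trans (absv_sub_ultra _ _))// absv1 ge_max ?t1 ?t2.
Qed.

(** As [r <= 1] forces [|t| <= 1], the identity [t u - 1 = t (u - 1) + (t - 1)] bounds the product;
    its inverse is treated in the same way. *)
Lemma symball_mul_le1 r s t u :
  r <= s -> r <= 1 -> ball r t -> ball s u -> ball s (t * u).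
Proof.
move=> rs r1.
have le1 v w : ball r v -> absv (w - 1) <= s -> absv (v * w - 1) <= s.
  move=> rv sw; have -> : v * w - 1 = v * (w - 1) + (v - 1) by ring.
  rewrite (le_trans (absv_ultra _ _))// ge_max absvM.
  have [_ v1 _] := rv; rewrite (le_trans v1 rs) andbT.
  have := symball_absv_le rv; rewrite max_r// => ? .
  by rewrite (le_trans _ sw)// ler_piMl ?absv_ge0.
move=> rt [Hu u1 u2]; have [Ht _ _] := rt; split; first exact: fiM.
  exact: le1.
by rewrite invfM; apply: le1 => //; exact: symballV.
Qed.

Lemma symball_absv_ge r t : ball r t -> (Num.max r 1)^-1 <= absv t.
Proof.
move=> rt; have m0 : 0 < Num.max r 1 by rewrite lt_max ltr01 orbT.
have [Ht _ _] := rt; rewrite -[leRHS]invrK lef_pV2 ?posrE ?invr_gt0//.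
  by rewrite -absvV; apply/symball_absv_le/symballV.
by rewrite absv_gt0 (fi_neq0 Ht).
Qed.

(** A limit point [x] has a ball element [y] so near that [x / y] lies in [H] and [|x| = |y|]; the
    three conditions then pass from [y] to [x]. *)
Lemma closed_symball r : closed (ball r).
Proof.
have [d d0 Hd] := open_subgroup.
set m := (Num.max r 1)^-1.
have m0 : 0 < m by rewrite invr_gt0 lt_max ltr01 orbT.
(* If [|x - y| < e], the ultrametric inequality gives [|x - 1| <= |y - 1|]; for [x = 1] this is
   trivial and [e] is set to 1. *)
move=> x clx; pose e := if x == 1 then 1 else absv (x - 1).
have e0 : 0 < e by rewrite /e; case: eqVneq => // x1; rewrite absv_gt0 subr_eq0.
have /clx[y [ry /=]] : nbhs x [set y | absv (x - y) < Num.min e (m * Num.min d 1)].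
  apply/nbhs_absvP; exists (Num.min e (m * Num.min d 1)) => //.
  by rewrite lt_min e0 mulr_gt0// lt_min d0 ltr01.
rewrite lt_min => /andP[xye xy].
have [Hy y1 y2] := ry; have y0 := fi_neq0 Hy.
have ay0 : 0 < absv y by rewrite absv_gt0.
have my : m <= absv y := symball_absv_ge ry.
have xyd : absv (x - y) < absv y * Num.min d 1.
  by rewrite (lt_le_trans xy)// ler_wpM2r// le_min (ltW d0) ler01.
have xyE : absv x = absv y.
  by apply: absv_eq_near; rewrite (lt_le_trans xyd)// ler_piMr ?ge_min ?lexx ?orbT// ltW.
have x0 : x != 0 by rewrite -absv_gt0 xyE.
have x1y1 : absv (x - 1) <= absv (y - 1).
  move: xye; rewrite /e; case: eqVneq => [->|_ xy1]; first by rewrite subrr absv0 absv_ge0.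
  have : absv (x - 1) <= Num.max (absv (x - y)) (absv (y - 1)).
    by rewrite -[x - 1](subrKA y) absv_ultra.
  by rewrite le_max leNgt xy1.
split.
- have -> : x = y * (1 + (x - y) / y) by field.
  apply: fiM => //; apply: Hd; rewrite absvM absvV ltr_pdivrMr// mulrC.
  by rewrite (lt_le_trans xyd)// ler_wpM2l ?absv_ge0// ge_min lexx.
- exact: le_trans y1.
- have inv1 z : z != 0 -> absv (z^-1 - 1) = absv (z - 1) / absv z.
    by move=> z0; rewrite -absvV -absvM mulrBl mul1r mulfV// absv_distC.
  rewrite inv1// (le_trans _ y2)// inv1// xyE.
  by rewrite ler_wpM2r// invr_ge0 absv_ge0.
Qed.

Lemma compact_symball r : compact (ball r).
Proof.
apply: subclosed_compact (@closed_symball r) (@compact_absv_le _ k (Num.max r 1)) _.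
by move=> t; exact: symball_absv_le.
Qed.

(** By compactness the outer radius is attained at an element of [H], by which balls can be
    translated. *)
Lemma symball_max_absv r : 0 <= r ->
  exists g, ball r g /\ forall t, ball r t -> absv t <= absv g.
Proof.
move=> r0; have b0 : ball r !=set0 by exists 1; exact: symball1.
have /(compact_EVT_max b0 (@compact_symball r))[g /[!inE] rg gmax] :
    {within ball r, continuous (absv : k -> R)}.
  by apply: continuous_subspaceT; exact: absv_continuous.
by exists g; split=> // t rt; apply: gmax; rewrite inE.
Qed.

(** The infimum of the admissible radii is admissible, the inequalities being closed, so
    [smallest_ball] does not fall back on its default. *)
Lemma smallest_ballP X r : 0 <= r -> X `<=` ball r ->
  exists s, [/\ 0 <= s, smallest_ball H X = ball s, X `<=` ball s &
    forall s', 0 <= s' -> X `<=` ball s' -> ball s `<=` ball s'].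
Proof.
move=> r0 Xr; pose E := [set s | 0 <= s /\ X `<=` ball s].
have E0 : E !=set0 by exists r.
have lbE : lbound E 0 by move=> s [].
have Einf s : E s -> inf E <= s by move=> Es; apply: ge_inf => //; exists 0.
have sm : is_smallest_ball H X (ball (inf E)).
  split; first by exists (inf E) => //; exact: lb_le_inf.
    move=> t Xt; split; first by have [] := Xr _ Xt.
      by apply: lb_le_inf => // s [_ /(_ _ Xt)[]].
    by apply: lb_le_inf => // s [_ /(_ _ Xt)[]].
  by move=> s s0 Xs; apply: symball_homo; exact: Einf.
have [[s s0 sE] sX smin] : is_smallest_ball H X (smallest_ball H X).
  exact: (xgetPex setT (ex_intro _ _ sm)).
by exists s; split; rewrite -?sE.
Qed.

End SymmetricBall.

(** * Haar measure of symmetric balls *)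

Section HaarMeasure.
Variables (R : realType) (k : localFieldType R) (H : fiSubgroup k).
Hypothesis open_subgroup :
  exists2 d : R, 0 < d & forall z, absv z < d -> H (1 + z).
Variable mu : {measure set (g_sigma_algebraType (@open (kstar k))) -> \bar R}.
Hypothesis haar : is_haar mu.
Local Notation T := (g_sigma_algebraType (@open (kstar k))).
Local Notation pre A := (@kstar_val R k @^-1` A : set T).
Local Notation ball := (symmetric_ball H).
Implicit Types (r s : R) (A : set k).

Lemma measurable_kstar_closed (A : set (kstar k)) :
  closed A -> measurable (A : set T).
Proof.
move=> cA; rewrite -[A]setCK; apply: (@measurableC _ T).
by apply: sub_sigma_algebra; exact: closed_openC.
Qed.

Lemma measurable_pre_closed A : closed A -> measurable (pre A).
Proof. by move=> /closed_kstar_preimage; exact: measurable_kstar_closed. Qed.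

Lemma measurable_symball r : measurable (pre (ball r)).
Proof. by apply: measurable_pre_closed; exact: closed_symball. Qed.

Lemma closed_mulr A a : closed A -> closed [set x | A (a * x)].
Proof. by apply: preimage_closed => x _; exact: mulr_absv_continuous. Qed.

Lemma haar_mul A a : a != 0 -> closed A -> mu (pre [set x | A (a * x)]) = mu (pre A).
Proof.
move=> a0 cA; have [inv _ _] := haar.
rewrite -(inv (to_kstar a0)); last first.
  by apply: measurable_pre_closed; exact: closed_mulr.
congr (mu _); apply/seteqP; split=> [y [x /= Ax yE]|y Ay] /=.
  by rewrite yE.
have ya0 : a^-1 * kstar_val y != 0 by rewrite mulf_neq0 ?invr_eq0 ?kstar_val_neq0.
by exists (to_kstar ya0); rewrite /= !to_kstarK mulVKf.
Qed.

Lemma haar_fin_num A : compact A -> closed A -> ~ A 0 -> mu (pre A) \is a fin_num.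
Proof.
move=> cA clA A0; have [_ fin _] := haar.
rewrite ge0_fin_numE ?measure_ge0//.
by apply: fin; exact: compact_kstar_preimage.
Qed.

Lemma symball_fin_num r : mu (pre (ball r)) \is a fin_num.
Proof.
apply: haar_fin_num; [exact: compact_symball|exact: closed_symball|].
by move=> [/fi_neq0/eqP].
Qed.

Lemma haar_pre_le A B : closed A -> closed B -> A `<=` B ->
  (mu (pre A) <= mu (pre B))%E.
Proof.
move=> cA cB AB; apply: le_measure; rewrite ?inE; try exact: measurable_pre_closed.
by move=> x; exact: AB.
Qed.

Lemma closed_set1_absv (x : k) : closed [set x].
Proof.
move=> y cly; apply: contrapT => yx.
have yx0 : 0 < absv (y - x) by rewrite absv_gt0 subr_eq0; exact/eqP.
have /cly[z [/= ->]] : nbhs y [set z | absv (y - z) < absv (y - x)].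
  by apply/nbhs_absvP; exists (absv (y - x)).
by rewrite ltxx.
Qed.

(* The points 1 + t^n, with |t| < 1, all lie in the compact unit sphere and
   have the same mass. *)
Lemma haar_set1 : mu (pre [set 1]) = 0%E.
Proof.
have [t t0 t1] := exists_absv_lt1 k.
pose u n : k := 1 + t ^+ n.+1.
have tn n : absv (t ^+ n.+1) < 1 by rewrite absvX exprn_ilt1// absv_ge0.
have u1 n : absv (u n) = 1 by exact: absv_1D.
have u0 n : u n != 0 by rewrite -absv_gt0 u1.
have uinj m n : (m < n)%N -> u m != u n.
  move=> mn; rewrite /u (inj_eq (addrI _)); apply/eqP => /(congr1 absv).
  rewrite !absvX => /eqP; rewrite gt_eqF// ltr_iXn2l//.
  by rewrite absv_gt0.
pose S := [set x : k | absv x = 1].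
have cS : closed S.
  have -> : S = [set x | absv x <= 1] `&` [set x | 1 <= absv x].
    apply/seteqP; split=> x /=; first by rewrite /S /= => ->.
    by move=> [x1 x2]; apply/eqP; rewrite eq_le x1.
  by apply: closedI; [exact: closed_absv_le|exact: closed_absv_ge].
have fS : mu (pre S) \is a fin_num.
  apply: haar_fin_num => //; last by rewrite /S /= absv0 => /esym/eqP; rewrite oner_eq0.
  by apply: subclosed_compact cS (@compact_absv_le _ k 1) _ => x /= ->.
pose P n := [set x | exists2 i, (i < n)%N & x = u i].
have cP n : closed (P n).
  elim: n => [|n ih]; first by have -> : P 0%N = set0; [apply/seteqP; split=> x []|exact: closed0].
  have -> : P n.+1 = P n `|` [set u n].
    apply/seteqP; split=> x.
      move=> [i]; rewrite ltnS leq_eqVlt => /orP[/eqP -> ->|ni ->]; first by right.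
      by left; exists i.
    by move=> [[i ni ->]|->]; [exists i => //; exact: ltnW|exists n].
  by apply: closedU => //; exact: closed_set1_absv.
have c1 := @closed_set1_absv 1.
pose m := mu (pre [set 1]).
have muu n : mu (pre [set u n]) = m.
  have un0 : (u n)^-1 != 0 by rewrite invr_eq0.
  rewrite /m -(haar_mul un0 c1); congr (mu _); apply/seteqP; split=> x /=.
    by move=> ->; rewrite mulVf.
  by move=> h; rewrite -[LHS](mulVKf (u0 n)) h mulr1.
have f1 : m \is a fin_num.
  apply: haar_fin_num => //; last by move=> /esym/eqP; rewrite /= oner_eq0.
  by apply: subclosed_compact c1 (@compact_absv_le _ k 1) _ => x /= ->; rewrite absv1.
have muP n : mu (pre (P n)) = (fine m *+ n)%:E.
  elim: n => [|n ih].
    by rewrite -[RHS](measure0 mu); congr (mu _); apply/seteqP; split=> x [].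
  have -> : pre (P n.+1) = pre (P n) `|` pre [set u n].
    apply/seteqP; split=> x.
      move=> [i]; rewrite ltnS leq_eqVlt => /orP[/eqP -> xn|ni xi]; first by right.
      by left; exists i.
    by move=> [[i ni xi]|xn]; [exists i => //; exact: (@ltn_trans n)|exists n].
  transitivity (mu (pre (P n)) + mu (pre [set u n]))%E; last first.
    by rewrite ih muu mulrSr EFinD fineK.
  apply: measureU.
  - exact: measurable_pre_closed (cP n).
  - exact: measurable_pre_closed (@closed_set1_absv (u n)).
  - apply/seteqP; split=> x //= -[[i ni ->] /eqP].
    by rewrite (negbTE (uinj i n ni)).
have PS n : fine m *+ n <= fine (mu (pre S)).
  by rewrite -lee_fin fineK// -muP; apply: haar_pre_le => // x [i _ ->].
rewrite -/m -(fineK f1); congr (_%:E); apply/eqP; rewrite eq_le fine_ge0 ?measure_ge0// andbT.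
rewrite leNgt; apply/negP => m0.
have := PS (Num.bound (fine (mu (pre S)) / fine m)).
rewrite leNgt -mulr_natr mulrC -ltr_pdivrMr//.
by rewrite archi_boundP// divr_ge0 ?fine_ge0 ?measure_ge0.
Qed.

Lemma haar_symball_gt0 r : 0 < r -> (0 < mu (pre (ball r)))%E.
Proof.
move=> r0; have [_ _ pos] := haar; have [d d0 Hd] := open_subgroup.
(* The bound [d] keeps the neighbourhood inside [H]; the bound 1 forces [|y| = 1], whence
   [|y^-1 - 1| = |y - 1|]. *)
pose e := Num.min r (Num.min d 1); have e0 : 0 < e by rewrite !lt_min r0 d0 ltr01.
pose U := [set x : k | absv (1 - x) < e].
have oU : open U.
  rewrite openE => x /= Ux; apply/nbhs_absvP; exists e => // y xy.
  rewrite /U /= -[1 - y](subrKA x) (le_lt_trans (absv_ultra _ _))//.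
  by rewrite gt_max Ux.
have opU : open (@kstar_val R k @^-1` U).
  by apply: open_comp => // x _; exact: kstar_val_continuous.
apply: lt_le_trans (pos _ opU _) _.
  by exists (to_kstar (oner_neq0 k)); rewrite /= to_kstarK /U /= subrr absv0.
apply: le_measure; rewrite ?inE.
- exact: sub_sigma_algebra.
- exact: measurable_symball.
move=> x; rewrite /U /= absv_distC !lt_min; set y := kstar_val x => /and3P[yr yd y1].
have ay : absv y = 1 by rewrite -[y](subrK 1) addrC absv_1D.
have y0 : y != 0 by rewrite -absv_gt0 ay.
split; [by rewrite -[y](subrK 1) addrC; exact: Hd|exact: ltW|].
have -> : y^-1 - 1 = (1 - y) / y by field.
by rewrite absvM absvV ay invr1 mulr1 absv_distC ltW.
Qed.

(** This is the form in which multiplicativity of cross-ratios yields the triangle inequality. If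
    the smaller radius is at most 1, the larger ball absorbs the product; otherwise both balls are
    annuli. *)
Lemma haar_symball_mul r s : 0 <= r -> 0 <= s -> exists2 q, 0 <= q &
  (forall t u, ball r t -> ball s u -> ball q (t * u)) /\
  (mu (pre (ball q)) <= mu (pre (ball r)) + mu (pre (ball s)))%E.
Proof.
wlog rs : r s / r <= s => [wl r0 s0|r0 s0].
  have [/wl|/ltW/wl] := leP r s; first exact.
  move=> /(_ s0 r0)[q q0 [rsq muq]]; exists q => //; split; last by rewrite addeC.
  by move=> t u rt su; rewrite mulrC; exact: rsq.
have [r1|r1] := leP r 1.
  exists s => //; split; last by rewrite leeDr ?measure_ge0.
  by move=> t u; exact: symball_mul_le1.
have s1 : 1 < s := lt_le_trans r1 rs.
have [g [rg gmax]] := symball_max_absv open_subgroup r0.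
have [h [sh hmax]] := symball_max_absv open_subgroup s0.
have [[Hg _ _] [Hh _ _]] := (rg, sh).
have [g0 h0] := (fi_neq0 Hg, fi_neq0 Hh).
have g1 : 1 <= absv g by rewrite -(absv1 k); exact/gmax/symball1.
have h1 : 1 <= absv h by rewrite -(absv1 k); exact/hmax/symball1.
have gr : absv g <= r by have := symball_absv_le rg; rewrite max_l// ltW.
have hs : absv h <= s by have := symball_absv_le sh; rewrite max_l// ltW.
have q1 : 1 <= absv g * absv h by rewrite mulr_ege1.
have [ag0 ah0] : 0 < absv g /\ 0 < absv h by rewrite !absv_gt0.
(* The radius is [|g| |h|] and not [r s]: the covering translates by elements of [H] whose absolute
   values are the outer radii. *)
exists (absv g * absv h); first exact: le_trans q1.
split.
  move=> t u rt su; have [[Ht _ _] [Hu _ _]] := (rt, su).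
  apply: absv_le_symball => //; first exact: fiM.
    by rewrite absvM ler_pM ?absv_ge0 ?gmax ?hmax.
  by rewrite invfM absvM ler_pM ?absv_ge0// ?gmax ?hmax//; exact: symballV.
(* Cut the annulus of outer radius |g h| along |t| = |g / h|: the two halves
   are the translates h^-1 B(r) and g B(s). *)
rewrite -(haar_mul h0 (closed_symball open_subgroup (r:=r))).
have gV0 : g^-1 != 0 by rewrite invr_eq0.
rewrite -(haar_mul gV0 (closed_symball open_subgroup (r:=s))).
have mb a p : measurable (pre [set x | ball p (a * x)]).
  by apply: measurable_pre_closed; apply: closed_mulr; exact: closed_symball.
apply: le_trans (measureU2 _ (mb _ _) (mb _ _)).
apply: le_measure; rewrite ?inE.
- exact: measurable_symball.
- exact: measurableU.
move=> x; rewrite /=; set t := kstar_val x => qt.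
have [Ht _ _] := qt; have t0 := fi_neq0 Ht.
have at0 : 0 < absv t by rewrite absv_gt0.
have := symball_absv_le qt; have := symball_absv_le (symballV qt).
rewrite max_l// => tV tq.
have [tgh|/ltW tgh] := leP (absv t) (absv g / absv h); [left|right].
  apply: absv_le_symball; [exact: ltW|exact: fiM| |]; apply: le_trans gr.
    by rewrite absvM mulrC -ler_pdivlMr.
  by rewrite invfM absvM absvV mulrC ler_pdivrMr.
apply: absv_le_symball; [exact: ltW|by apply: fiM => //; exact: fiV| |].
  by rewrite absvM absvV ler_pdivrMl// (le_trans tq)// (ler_wpM2l (ltW ag0) hs).
rewrite invfM invrK absvM absvV ler_pdivrMr//.
by apply: le_trans (ler_wpM2r (ltW at0) hs); rewrite mulrC -ler_pdivrMr.
Qed.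

End HaarMeasure.

(** * Representatives of points of the sphere *)

Section SphereReps.
Variables (k : fieldType) (H : fiSubgroup k) (V : vectType k).
Implicit Types (x y : sphere H V).

Lemma rep_neq0 x : rep x != 0.
Proof. exact: (set_mem (valP (repr x))). Qed.

Lemma rep_pi (v : nonzero V) :
  exists2 t, H t & rep (\pi_(sphere H V)%qT v) = t *: set_val v.
Proof.
have /eqmodP/asboolP[t Ht tE] :
    (\pi_(sphere H V) (repr (\pi_(sphere H V) v)) = \pi_(sphere H V) v)%qT.
  by rewrite reprK.
by exists t.
Qed.

Lemma rep_eq x y t : H t -> rep x = t *: rep y -> x = y.
Proof.
by move=> Ht xy; rewrite -[x]reprK -[y]reprK; apply/eqmodP/asboolP; exists t.
Qed.

End SphereReps.

(** * Hilbert distance on a proper set with bounded ratios of functionals *)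

Section HilbertMetric.
Variables (R : realType) (k : localFieldType R) (H : fiSubgroup k).
Hypothesis open_subgroup :
  exists2 d : R, 0 < d & forall z : k, absv z < d -> H (1 + z).
Variables (V : vectType k) (Omega : set (sphere H V)).
Hypotheses (proper : Hproper Omega)
  (bounded : forall x y, Omega x -> Omega y ->
     exists M : R, forall f, dual Omega f -> absv (pairing f x / pairing f y) <= M).
Variable mu : {measure set (g_sigma_algebraType (@open (kstar k))) -> \bar R}.
Hypothesis haar : is_haar mu.
Local Notation ball := (symmetric_ball H).
Implicit Types (x y z : sphere H V).

(** Exchanging [f] and [f'] inverts a cross-ratio, so one bound controls both it and its inverse;
    for [r >= 1] nothing more than this and membership in [H] is required. *)
Lemma cross_ratios_sub_ball x y : Omega x -> Omega y ->
  exists2 r : R, 0 <= r & cross_ratios Omega x y `<=` ball r.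
Proof.
move=> Ox Oy; have [M hM] := bounded Ox Oy; have [N hN] := bounded Oy Ox.
pose r := Num.max (`|N| * `|M|) 1.
have r1 : 1 <= r by rewrite le_max lexx orbT.
have bnd f f' : dual Omega f -> dual Omega f' ->
    absv (pairing f y / pairing f x * (pairing f' x / pairing f' y)) <= r.
  move=> df df'; rewrite absvM le_max; apply/orP; left.
  by rewrite ler_pM ?absv_ge0// (le_trans _ (ler_norm _)) ?hN ?hM.
exists r; first exact: le_trans r1.
move=> _ [f [f' [df df' ->]]]; apply: absv_le_symball => //.
- by do !apply: fiM; try apply: fiV; by [apply: df|apply: df'].
- exact: bnd.
- have -> : (cross_ratio f f' x y)^-1 = cross_ratio f' f x y.
    by rewrite /cross_ratio !(invfM, invrK); ring.
  exact: bnd.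
Qed.

(** On [Omega] the distance is the measure of an actual ball, never of the default [setT]. *)
Lemma hilbert_distP x y : Omega x -> Omega y -> exists r, [/\ 0 <= r,
  hilbert_dist mu Omega x y = mu (@kstar_val R k @^-1` ball r),
  cross_ratios Omega x y `<=` ball r &
  forall s, 0 <= s -> cross_ratios Omega x y `<=` ball s -> ball r `<=` ball s].
Proof.
move=> Ox Oy; have [r r0 Xr] := cross_ratios_sub_ball Ox Oy.
have [s [s0 sE Xs smin]] := smallest_ballP r0 Xr.
by exists s; split; rewrite // /hilbert_dist sE.
Qed.

Lemma symball0 : ball (0 : R) `<=` [set 1].
Proof.
move=> t [_ t1 _]; apply/eqP; rewrite -subr_eq0 /=; apply/eqP/(@absv_eq0 R).
by apply/eqP; rewrite eq_le t1 absv_ge0.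
Qed.

Lemma dual_neq0 x f : Omega x -> dual Omega f -> pairing f x != 0.
Proof. by move=> Ox /(_ _ Ox)/fi_neq0. Qed.

Theorem hilbert_dist_is_distance : is_distance_on Omega (hilbert_dist mu Omega).
Proof.
have mB := measurable_symball open_subgroup.
split=> [x y Ox Oy|x y Ox Oy|x y Ox Oy|x y z Ox Oy Oz].
- have [r [r0 -> _ _]] := hilbert_distP Ox Oy; split.
    exact: symball_fin_num.
  exact: measure_ge0.
- have [r [r0 -> Xr rmin]] := hilbert_distP Ox Oy; split=> [mur0|xy].
    have {}r0 : r = 0.
      apply/eqP; rewrite eq_le r0 andbT leNgt; apply/negP.
      by move=> /(haar_symball_gt0 open_subgroup haar); rewrite mur0 ltxx.
    rewrite r0 in Xr.
    (* With an empty dual every vector would be a common zero, against properness. *)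
    have [f0 df0] : exists f0, dual Omega f0.
      apply: contrapT => nodual; have := rep_neq0 x.
      suff -> : rep x = 0 by rewrite eqxx.
      have : [set v : V | forall f, dual Omega f -> rep f v = 0] (rep x).
        by move=> f df; case: nodual; exists f.
      by rewrite proper.
    (* All cross-ratios being 1, [f(x) / f(y)] takes the same value [l] for every [f], so [x - l y]
       is a common zero. *)
    set l := pairing f0 x / pairing f0 y.
    apply: (@rep_eq _ _ _ _ _ l).
      by apply: fiM; [exact: df0|apply: fiV; exact: df0].
    apply/eqP; rewrite -subr_eq0; apply/eqP.
    suff : [set v : V | forall f, dual Omega f -> rep f v = 0] (rep x - l *: rep y).
      by rewrite proper.
    move=> f df; rewrite linearB linearZ /= -/(pairing f x) -/(pairing f y).
    have /Xr/symball0/= : cross_ratios Omega x y (cross_ratio f f0 x y).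
      by exists f, f0.
    rewrite /cross_ratio -/l => h.
    have fx0 := dual_neq0 Ox df; have fy0 := dual_neq0 Oy df.
    apply/eqP; rewrite subr_eq0; apply/eqP.
    by rewrite -[LHS]mulr1 -h /GRing.scale /=; field.
  (* For equal points every cross-ratio is 1, so the smallest ball lies in the null set
     [[set 1]]. *)
  have /rmin r_sub : cross_ratios Omega x y `<=` ball (0 : R).
    move=> _ [f [f' [df df' ->]]]; rewrite /cross_ratio xy.
    by rewrite !divff ?mulr1 ?dual_neq0//; exact: symball1.
  apply/eqP; rewrite eq_le measure_ge0 andbT -(haar_set1 haar).
  apply: haar_pre_le; [exact: closed_symball|exact: closed_set1_absv|].
  by move=> t /(r_sub (lexx 0)); exact: symball0.
- rewrite /hilbert_dist; congr (mu (_ @^-1` smallest_ball H _)).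
  by apply/seteqP; split=> _ [f [f' [df df' ->]]]; exists f', f; split=> //;
    rewrite /cross_ratio mulrC.
- have [r [r0 -> Xr rmin]] := hilbert_distP Ox Oz.
  have [s [s0 -> Xs _]] := hilbert_distP Ox Oy.
  have [t [t0 -> Xt _]] := hilbert_distP Oy Oz.
  have [q q0 [stq muq]] := haar_symball_mul open_subgroup haar s0 t0.
  apply: le_trans muq; apply: haar_pre_le; try exact: closed_symball.
  apply: rmin => // _ [f [f' [df df' ->]]].
  have -> : cross_ratio f f' x z = cross_ratio f f' x y * cross_ratio f f' y z.
    by rewrite /cross_ratio; field; rewrite !dual_neq0.
  by apply: stq; [apply: Xs; exists f, f'|apply: Xt; exists f, f'].
Qed.

End HilbertMetric.

(** * Open subsets of the sphere and bounded ratios *)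

Section OpenSubsets.
Variables (R : realType) (k : localFieldType R) (n : nat).
Implicit Types (u v : 'rV[k]_n).

(** Neighbourhoods of a row vector are entrywise, and each entry is affine in [t]. *)
Lemma line_continuous u v : continuous (fun t : k => u + t *: v).
Proof.
move=> t A [P nP PA].
suff : \forall s \near t, forall i j, P i j ((u + s *: v) i j).
  by apply: filterS => s Ps; exact: PA.
apply: filter_forall => i; apply: filter_forall => j.
have c : continuous (fun s : k => u i j + v i j * s).
  move=> s; apply: (@continuous_comp _ _ _ ( *%R (v i j)) ( +%R (u i j))).
    exact: mulr_absv_continuous.
  exact: addr_absv_continuous.
have h : nbhs t [set s | P i j (u i j + v i j * s)].
  apply: c; have := nP i j; rewrite !mxE.
  by rewrite [t * _]mulrC.
by apply: filterS h => s /=; rewrite !mxE mulrC.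
Qed.

Lemma nbhs_row_neq0 v : v != 0 -> nbhs v [set u | u != 0].
Proof.
move=> v0; have [j vj] : exists j, v 0 j != 0.
  apply: contrapT => vn; move/negP: v0; apply; apply/eqP/rowP => j.
  by rewrite mxE; apply/eqP; apply: contrapT => /negP vj; apply: vn; exists j.
exists (fun i' j' => [set x | v i' j' != 0 -> x != 0]).
  move=> i' j'; have [_|/nbhs_neq0] := eqVneq (v i' j') 0; first exact: nearW.
  by apply: filterS => x x0 _.
by move=> u uP; have /= := uP 0 j vj; apply: contraNneq => ->; rewrite mxE.
Qed.

(* If phi(y) + t phi(x) = 0, then y + t x lies outside the cone over Omega, so
   t cannot be small. *)
Lemma sphere_open_bounded (H : fiSubgroup k) (Omega : set (sphere H 'rV[k]_n)) :
  sphere_open Omega -> forall x y, Omega x -> Omega y ->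
  exists M : R, forall f, dual Omega f -> absv (pairing f x / pairing f y) <= M.
Proof.
move=> [W oW WE] x y Ox Oy.
have Wy : W (rep y).
  suff : (set_val @^-1` W) (repr y) by [].
  by rewrite WE /=; move: Oy; rewrite -{1}[y]reprK.
have /nbhs_absvP[e e0 eW] :
    nbhs (0 : k) [set t | W (rep y + t *: rep x) /\ rep y + t *: rep x != 0].
  have yE : rep y = rep y + (0 : k) *: rep x by rewrite scale0r addr0.
  have nW : nbhs (rep y) (W `&` [set u | u != 0]).
    by apply: filterI; [exact: open_nbhs_nbhs|exact/nbhs_row_neq0/rep_neq0].
  by rewrite yE in nW; exact: line_continuous nW.
exists e^-1 => f df.
have fx := fi_neq0 (df _ Ox); have fy := fi_neq0 (df _ Oy).
rewrite -[X in absv X]invrK invf_div absvV lef_pV2 ?posrE//; last first.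
  by rewrite absv_gt0 mulf_neq0 ?invr_eq0.
rewrite leNgt; apply/negP => lte.
have [|Wt t0] := eW (- (pairing f y / pairing f x)).
  by rewrite sub0r opprK.
pose v : nonzero 'rV[k]_n := SigSub (mem_set (t0 : nonzero 'rV[k]_n _)).
have Ov : Omega (\pi_(sphere H 'rV[k]_n) v)%qT.
  by have : (set_val @^-1` W) v by []; rewrite WE.
have [s Hs sE] := rep_pi H v.
have := fi_neq0 (df _ Ov); rewrite /pairing sE linearZ /= linearD linearZ /=.
rewrite -/(pairing f x) -/(pairing f y) scaleNr /GRing.scale /= divfK//.
by rewrite subrr mulr0 eqxx.
Qed.

End OpenSubsets.

(** * Lower bound for anisotropic binary quadratic forms *)

Section BinaryForm.
Variables (R : realType) (k : localFieldType R).
Implicit Types (x y z p q : k).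

(* Completing the square, z F = (z p - y q)^2 + D q^2 with - D not a square,
   so the two squares cannot cancel beyond the radius given by Newton's
   method. *)
Lemma anisotropic_lower_bound x y z : (2 : k) != 0 ->
  (forall p q, (p != 0) || (q != 0) -> z * p ^+ 2 - 2 * y * p * q + x * q ^+ 2 != 0) ->
  exists2 C : R, 0 < C & forall p q,
    absv (p ^+ 2) <= C * absv (z * p ^+ 2 - 2 * y * p * q + x * q ^+ 2) /\
    absv (q ^+ 2) <= C * absv (z * p ^+ 2 - 2 * y * p * q + x * q ^+ 2).
Proof.
move=> n2; set F := fun p q => z * p ^+ 2 - 2 * y * p * q + x * q ^+ 2 => Fn0.
have z0 : z != 0.
  have := Fn0 1 0; rewrite oner_neq0 => /(_ isT); apply: contraNneq => ->.
  by rewrite /=; apply/eqP; ring.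
set D := x * z - y ^+ 2.
have zF p q : z * F p q = (z * p - y * q) ^+ 2 + D * q ^+ 2 by rewrite /F /D; ring.
have Dns s : - D != s ^+ 2.
  (* A square root [s] of [- D] would give the form the zero [((s + y) / z, 1)]. *)
  apply/eqP => Ds; have := Fn0 ((s + y) / z) 1; rewrite oner_neq0 orbT.
  move=> /(_ isT)/negP; apply; rewrite -(inj_eq (mulfI z0)) mulr0.
  rewrite -/(F _ _) zF; apply/eqP.
  have -> : D = - s ^+ 2 by rewrite -Ds opprK.
  by field.
have [d d0 dsq] := near1_square n2.
have az0 : 0 < absv z by rewrite absv_gt0.
have D0 : D != 0 by have := Dns 0; rewrite expr0n /= oppr_eq0.
have aD0 : 0 < absv D by rewrite absv_gt0.
(* The entry 1 of the maximum serves [zFN], the entry [d^-1] serves [bA]. *)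
pose N := absv z * Num.max 1 d^-1.
have N0 : 0 < N by rewrite mulr_gt0// lt_max ltr01.
have zFN p q : absv (z * F p q) <= N * absv (F p q).
  by rewrite absvM ler_wpM2r ?absv_ge0// /N ler_pMr// le_max lexx.
have bA p q : absv ((z * p - y * q) ^+ 2) <= N * absv (F p q).
  set A := z * p - y * q.
  have [->|A0] := eqVneq A 0.
    by rewrite expr0n/= absv0 mulr_ge0 ?absv_ge0// ltW.
  have A20 : 0 < absv (A ^+ 2) by rewrite absv_gt0 expf_neq0.
  suff dA : d * absv (A ^+ 2) <= absv (z * F p q).
    rewrite /N mulrAC -absvM -[leLHS](mulKf (lt0r_neq0 d0)) mulrC.
    by rewrite ler_pM ?invr_ge0 ?mulr_ge0 ?absv_ge0 ?(ltW d0)// le_max lexx orbT.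
  (* Otherwise [1 - z F / A^2] is a square [w^2], so [- D q^2 = (w A)^2] and [- D] is a square. *)
  rewrite leNgt; apply/negP => ltd.
  have [w w0 wE] : exists2 w, w != 0 & 1 + - (z * F p q / A ^+ 2) = w ^+ 2.
    by apply: dsq; rewrite absvN absvM absvV ltr_pdivrMr.
  have {}wE : - (D * q ^+ 2) = (w * A) ^+ 2.
    by rewrite exprMn -wE zF -/A; field.
  have q0 : q != 0.
    apply: contra_eq_neq wE => ->; rewrite expr0n/= mulr0 oppr0 eq_sym.
    by rewrite expf_neq0// mulf_neq0.
  have /eqP := Dns (w * A / q); apply.
  by rewrite expr_div_n -wE; field.
have bq p q : absv (q ^+ 2) <= N / absv D * absv (F p q).
  rewrite mulrAC ler_pdivlMr// mulrC -absvM.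
  have -> : D * q ^+ 2 = z * F p q - (z * p - y * q) ^+ 2 by rewrite zF; ring.
  by rewrite (le_trans (absv_sub_ultra _ _))// ge_max zFN bA.
(* Adds the bounds for the two terms of [z p = (z p - y q) + y q], then divides by [|z|^2]. *)
pose M := (N + absv (y ^+ 2) * (N / absv D)) / absv (z ^+ 2).
have N'0 : 0 <= absv (y ^+ 2) * (N / absv D).
  by rewrite mulr_ge0 ?divr_ge0 ?absv_ge0 ?(ltW N0).
have M0 : 0 <= M by rewrite divr_ge0 ?addr_ge0 ?absv_ge0 ?(ltW N0).
have sq_le u w : absv u <= absv w -> absv (u ^+ 2) <= absv (w ^+ 2).
  by rewrite !absvX => uw; rewrite lerXn2r ?nnegrE ?absv_ge0.
have bp p q : absv (p ^+ 2) <= M * absv (F p q).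
  rewrite /M mulrAC ler_pdivlMr ?absv_gt0 ?expf_neq0// mulrC -absvM -exprMn.
  have -> : z * p = (z * p - y * q) + y * q by ring.
  have : absv ((z * p - y * q) + y * q) <= Num.max (absv (z * p - y * q)) (absv (y * q)).
    exact: absv_ultra.
  rewrite mulrDl le_max => /orP[/sq_le|/sq_le] /le_trans; apply.
    by rewrite (le_trans (bA p q))// lerDl mulr_ge0 ?absv_ge0.
  rewrite exprMn absvM -(mulrA (absv (y ^+ 2))) -[leLHS]add0r lerD//.
    by rewrite mulr_ge0 ?absv_ge0 ?(ltW N0).
  by rewrite ler_wpM2l ?absv_ge0.
exists (N / absv D + M).
  by rewrite ltr_wpDr ?divr_gt0.
move=> p q; rewrite -/(F p q) mulrDl; split.
  by rewrite (le_trans (bp p q))// lerDr mulr_ge0 ?absv_ge0 ?divr_ge0 ?absv_ge0 ?(ltW N0).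
by rewrite (le_trans (bq p q))// lerDl mulr_ge0 ?absv_ge0.
Qed.

End BinaryForm.

(** * The bilinear form and the cone [coneC1] *)

Lemma ord3P (i : 'I_3) : [\/ i = 0, i = 1 | i = 2].
Proof.
by case: i => [[|[|[|//]]] i3];
  [apply: Or31|apply: Or32|apply: Or33]; exact: val_inj.
Qed.

Section Polar.
Variables (R : realType) (k : localFieldType R).
Implicit Types (v w : 'rV[k]_3).

(** This is [B(v, w)] with the division by 2 carried out, seen as a functional of [v]. *)
Definition polar w v : k^o :=
  v 0 0 * w 0 2 + v 0 2 * w 0 0 - 2 * v 0 1 * w 0 1.

Lemma polar_is_linear w : linear (polar w).
Proof. by move=> a u v; rewrite /polar !mxE /GRing.scale /=; ring. Qed.

HB.instance Definition _ w :=
  GRing.isLinear.Build k 'rV[k]_3 k^o _ (polar w) (polar_is_linear w).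

Lemma bilinBE v w : (2 : k) != 0 -> bilinB v w = polar w v.
Proof. by move=> n2; rewrite /bilinB /quadQ /polar !mxE; field. Qed.

(** The Veronese parametrisation of [coneC1], which turns [B(v, .)] into a binary quadratic form. *)
Definition cone_vector (p q : k) : 'rV[k]_3 :=
  \row_i (if i == 0 then p ^+ 2 else if i == 1 then p * q else q ^+ 2).

Lemma polar_cone_vector p q v :
  polar (cone_vector p q) v
  = v 0 2 * p ^+ 2 - 2 * v 0 1 * p * q + v 0 0 * q ^+ 2.
Proof. by rewrite /polar !mxE /=; ring. Qed.

Lemma cone_vector_neq0 p q : (p != 0) || (q != 0) -> cone_vector p q != 0.
Proof.
rewrite -negb_and; apply: contraNneq => /rowP c0.
have := c0 0; have := c0 2; rewrite !mxE /= => /eqP + /eqP.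
by rewrite !expf_eq0 /= => -> ->.
Qed.

(* In coneC1 the vector is compared to 0 as a function of two indices. *)
Lemma coneC1_neq0 w : coneC1 w -> w != 0.
Proof.
move=> [w0 _ _ _]; apply: contraNneq w0 => ->; apply/eqP.
by apply/funext => i; apply/funext => j; rewrite mxE.
Qed.

Lemma cone_vectorP w :
  @coneC1 R k w <-> exists p q, [/\ (p != 0) || (q != 0) & w = cone_vector p q].
Proof.
split=> [cw|[p [q [pq ->]]]]; last first.
  split.
  - apply: contraNneq (cone_vector_neq0 pq) => c0; apply/eqP/matrixP => i j.
    by rewrite c0 mxE.
  - by rewrite !mxE /=; ring.
  - by exists p; rewrite mxE.
  - by exists q; rewrite mxE.
have w0 := coneC1_neq0 cw; have [_ wE [p pE] [q qE]] := cw.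
(* The middle entry is [p q] or [- p q]; the sign is absorbed into [q]. *)
have [q' [q'E wq']] : exists q', w 0 2 = q' ^+ 2 /\ w 0 1 = p * q'.
  move: wE => /eqP; rewrite pE qE -exprMn eq_sym eqf_sqr => /orP[/eqP ->|/eqP ->].
    by exists q.
  by exists (- q); rewrite sqrrN mulrN.
have wc : w = cone_vector p q'.
  by apply/rowP => i; rewrite !mxE; case: (ord3P i) => -> /=.
exists p, q'; split=> //; rewrite -negb_and; apply: contraNN w0.
move=> /andP[/eqP p0 /eqP q0]; apply/eqP; rewrite wc p0 q0; apply/rowP => i.
by case: (ord3P i) => ->; rewrite !mxE /= ?mulr0 ?expr0n.
Qed.

(** Nondegeneracy of [B], tested on the standard basis; it lets [polar w] define a point of the dual
    sphere. *)
Lemma polar_neq0 w : (2 : k) != 0 -> w != 0 -> linfun (polar w) != 0.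
Proof.
move=> n2; apply: contraNneq => /lfunP w0; apply/eqP/rowP => i; rewrite mxE.
have p0 v : polar w v = 0 by have := w0 v; rewrite lfunE zero_lfunE.
have w0E : w 0 0 = 0.
  by have := p0 (delta_mx 0 2); rewrite /polar !mxE /= !(mul0r, mulr0, mul1r, add0r, subr0).
have w2E : w 0 2 = 0.
  by have := p0 (delta_mx 0 0); rewrite /polar !mxE /= !(mul0r, mulr0, mul1r, addr0, subr0).
have w1E : w 0 1 = 0.
  have := p0 (delta_mx 0 1); rewrite /polar !mxE /= !(mul0r, mulr1, add0r).
  by move=> /eqP; rewrite oppr_eq0 mulf_eq0 (negbTE n2) => /eqP.
by case: (ord3P i) => ->.
Qed.

End Polar.

(** * The hyperbolic disc: openness, convexity and properness *)

Section HyperbolicDisc.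
Variables (R : realType) (k : localFieldType R) (alpha : squareClass k).
Hypotheses (char2 : 2%N \notin [pchar k]) (alphaN1 : ~ alpha (-1)).
Local Notation K := (Kgroup char2 alphaN1).
Local Notation D := (hyp_disc char2 alphaN1).
Local Notation V := 'rV[k]_3.

Lemma char2_neq0 : (2 : k) != 0.
Proof. by apply: contraNneq char2 => h; rewrite inE/= h eqxx. Qed.

Lemma Kgroup_open : exists2 d : R, 0 < d & forall z : k, absv z < d -> K (1 + z).
Proof.
have [d d0 dsq] := near1_square char2_neq0.
by exists d => // z /dsq[w w0 ->]; exact: Kset_sqr.
Qed.

Lemma hyp_coneP (v : V) : hyp_cone alpha v <->
  forall p q, (p != 0) || (q != 0) ->
    K (v 0 2 * p ^+ 2 - 2 * v 0 1 * p * q + v 0 0 * q ^+ 2).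
Proof.
split=> [hv p q pq|hv w /cone_vectorP[p [q [pq ->]]]].
  rewrite -polar_cone_vector -bilinBE ?char2_neq0//; apply: hv.
  by apply/cone_vectorP; exists p, q.
by rewrite bilinBE ?char2_neq0// polar_cone_vector; exact: hv.
Qed.

Lemma hyp_coneZ t (v : V) : K t -> hyp_cone alpha v -> hyp_cone alpha (t *: v).
Proof.
move=> Kt hv w cw; have := fiM Kt (hv w cw).
by rewrite !bilinBE ?char2_neq0// linearZ.
Qed.

Lemma hyp_disc_repE x : D x <-> hyp_cone alpha (rep x).
Proof.
split=> [[v hv <-]|hx]; last by exists (repr x) => //; exact: reprK.
by have [t Kt ->] := rep_pi K v; exact: hyp_coneZ.
Qed.

(** The forms [F] and [G] of [v] and a nearby [u] satisfy [|G - F| < d |F|] uniformly in [p] and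
    [q], because the lower bound dominates every monomial by [C |F|]. Hence [G / F] lies in [K]. *)
Lemma open_hyp_cone : open (hyp_cone alpha).
Proof.
rewrite openE => v hv; have /hyp_coneP Kv := hv.
have [d d0 Hd] := Kgroup_open.
have [||C C0 lb] := @anisotropic_lower_bound R k (v 0 0) (v 0 1) (v 0 2).
- exact: char2_neq0.
- by move=> p q /Kv/fi_neq0.
exists (fun i j => [set x | absv (v i j - x) < d / C]).
  by move=> i j; apply/nbhs_absvP; exists (d / C); rewrite ?divr_gt0.
move=> u uv; apply/hyp_coneP => p q pq; have Kp := Kv _ _ pq.
have [lp lq] := lb p q; move: Kp lp lq.
set F := _ + v 0 0 * q ^+ 2 => KF lp lq; have F0 := fi_neq0 KF.
have aF0 : 0 < absv F by rewrite absv_gt0.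
set G := _ + u 0 0 * q ^+ 2.
have -> : G = F * (1 + (G - F) / F) by field.
apply: fiM => //; apply: Hd; rewrite absvM absvV ltr_pdivrMr//.
have small a s : absv a < d / C -> absv s <= C * absv F -> absv (a * s) < d * absv F.
  move=> aC sC; rewrite absvM.
  apply: le_lt_trans (ler_wpM2l (absv_ge0 _) sC) _.
  by rewrite mulrA ltr_pM2r// -ltr_pdivlMr.
(* Here [|2| <= 1], and [|p q|] is at most the larger of [|p^2|] and [|q^2|]. *)
have lpq : absv (2 * p * q) <= C * absv F.
  have a2 : absv (2 : k) <= 1.
    by have := absv_ultra (1 : k) 1; rewrite absv1 maxxx.
  rewrite -mulrA absvM (le_trans (ler_piMl (absv_ge0 _) a2))//.
  have [h|/ltW h] := leP (absv p) (absv q).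
    by apply: le_trans lq; rewrite absvM absvX ler_wpM2r ?absv_ge0.
  by apply: le_trans lp; rewrite absvM absvX ler_wpM2l ?absv_ge0.
have -> : G - F = - ((v 0 2 - u 0 2) * p ^+ 2) + (v 0 1 - u 0 1) * (2 * p * q)
    - (v 0 0 - u 0 0) * q ^+ 2 by rewrite /G /F; ring.
rewrite (le_lt_trans (absv_sub_ultra _ _))// gt_max small ?andbT//; last exact: uv.
rewrite (le_lt_trans (absv_ultra _ _))// gt_max absvN !small//; exact: uv.
Qed.

(** The chosen representative of the class of [polar w] may differ from it by a factor [t], harmless
    because [t] lies in [K]. *)
Lemma cone_functional (w : V) : coneC1 w -> exists2 f, dual D f &
  exists2 t, K t & forall v, rep f v = t * polar w v.
Proof.
move=> cw; have w0 := coneC1_neq0 cw.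
have f0 := polar_neq0 char2_neq0 w0.
pose fw : nonzero 'Hom(V, k^o) := SigSub (mem_set (f0 : nonzero 'Hom(V, k^o) _)).
have [t Kt tE] := rep_pi K fw.
have fE v : rep (\pi_(sphere K 'Hom(V, k^o)) fw)%qT v = t * polar w v.
  by rewrite tE scale_lfunE /= lfunE.
exists (\pi_(sphere K 'Hom(V, k^o)) fw)%qT; last by exists t.
move=> x /hyp_disc_repE hx; rewrite /pairing fE; apply: fiM => //.
by rewrite -bilinBE ?char2_neq0//; exact: hx.
Qed.

(** The inclusion with content takes a point of the bidual and evaluates on it the functionals
    [B(., w)], [w] in [coneC1]; this is the definition of the cone. *)
Lemma hyp_disc_convex : Hconvex D.
Proof.
apply/seteqP; split=> [x Dx f|x hx]; first exact.
apply/hyp_disc_repE => w cw; have [f df [t Kt fE]] := cone_functional cw.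
have := fiM (fiV Kt) (hx f df); rewrite /pairing fE mulKf ?(fi_neq0 Kt)//.
by rewrite bilinBE ?char2_neq0.
Qed.

(** The cone vectors with parameters [(1, 0)], [(0, 1)] and [(1, 1)] span [k^3], so their
    functionals have only 0 as common zero. *)
Lemma hyp_disc_proper : Hproper D.
Proof.
apply/seteqP; split=> [v hv|v -> f _]; last by rewrite linear0.
have pv0 p q : (p != 0) || (q != 0) -> polar (cone_vector p q) v = 0.
  move=> pq; have [|f df [t Kt fE]] := @cone_functional (cone_vector p q).
    by apply/cone_vectorP; exists p, q.
  have /eqP := hv _ df; rewrite fE mulf_eq0 (negbTE (fi_neq0 Kt)) /=.
  by move=> /eqP.
have v2 : v 0 2 = 0.
  have := pv0 1 0; rewrite oner_neq0 => /(_ isT); rewrite polar_cone_vector => <-.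
  by ring.
have v0 : v 0 0 = 0.
  have := pv0 0 1; rewrite oner_neq0 orbT => /(_ isT); rewrite polar_cone_vector => <-.
  by ring.
have v1 : v 0 1 = 0.
  have := pv0 1 1; rewrite oner_neq0 => /(_ isT).
  rewrite polar_cone_vector v0 v2 !(mul0r, expr1n, mulr1, addr0, add0r).
  by move=> /eqP; rewrite oppr_eq0 mulf_eq0 (negbTE char2_neq0) => /eqP.
apply/rowP => i; rewrite mxE.
by case: (ord3P i) => ->.
Qed.

(** The cone is stable under [K], so the preimage of the disc among nonzero vectors is the trace of
    the open set [hyp_cone]. *)
Lemma hyp_disc_open : sphere_open D.
Proof.
exists (hyp_cone alpha); first exact: open_hyp_cone.
apply/seteqP; split=> v /=.
  by exists v.
move=> /hyp_disc_repE; have [t Kt ->] := rep_pi K v => /(hyp_coneZ (fiV Kt)).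
by rewrite scalerA mulVf ?(fi_neq0 Kt)// scale1r.
Qed.

End HyperbolicDisc.

Theorem corollary2 (R : realType) (k : localFieldType R)
    (char2 : 2%N \notin [pchar k])
    (alpha : squareClass k) (alphaN1 : ~ alpha (-1)) :
  let D := hyp_disc char2 alphaN1 in
  [/\ Hconvex D, Hproper D, sphere_open D &
      forall mu : {measure set (g_sigma_algebraType (@open (kstar k))) -> \bar R},
        is_haar mu -> is_distance_on D (hilbert_dist mu D)].
Proof.
move=> D; split; [exact: hyp_disc_convex|exact: hyp_disc_proper|exact: hyp_disc_open|].
move=> mu haar; apply: hilbert_dist_is_distance haar.
- exact: Kgroup_open.
- exact: hyp_disc_proper.
- exact/sphere_open_bounded/hyp_disc_open.
Qed.
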